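(* Let $a>\lambda>0$, $T>t_0\ge 0$, $x_0\in[-1,1]$, and put $\rho=\frac{1}{\lambda}\ln\frac{a}{a-\lambda}>0$. If $\rho\ge 2a^{-1}$, then problem $(FP_3)$ has a unique local solution $(\bar x,\bar u)$, which is a unique global solution, where $\bar u(t)=-a^{-1}\dot{\bar x}(t)$ for almost every $t\in[t_0,T]$ and $\bar x$ is described as follows. (a) If $T-t_0\le a^{-1}(1+x_0)$, then $\bar x(t)=x_0-a(t-t_0)$ for $t\in[t_0,T]$. (b) If $a^{-1}(1+x_0)<T-t_0<a^{-1}(3-x_0)$, then $$\bar x(t)=\begin{cases} x_0+a(t-t_0), & t\in[t_0,t_\zeta],\\ -1-a(t-T), & t\in(t_\zeta,T],\end{cases}$$ with $t_\zeta:=2^{-1}[T+t_0-a^{-1}(1+x_0)]$. (c) If $T-t_0\ge a^{-1}(3-x_0)$, then $$\bar x(t)=\begin{cases} x_0+a(t-t_0), & t\in[t_0,t_0+a^{-1}(1-x_0)],\\ 1, & t\in(t_0+a^{-1}(1-x_0),\,T-2a^{-1}],\\ -1-a(t-T), & t\in(T-2a^{-1},T].\end{cases}$$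
   Context: Given constants $a>\lambda>0$, $T>t_0\ge 0$ and $x_0\in[-1,1]$, $(FP_3)$ denotes the optimal control problem: minimize $J(x,u)=\int_{t_0}^{T}\big[-e^{-\lambda t}(x(t)+u(t))\big]\,dt$ over $x\in W^{1,1}([t_0,T],\mathbb{R})$ (absolutely continuous functions) and measurable $u:[t_0,T]\to\mathbb{R}$ satisfying $\dot x(t)=-a u(t)$ for a.e. $t\in[t_0,T]$; $x(t_0)=x_0$; $u(t)\in[-1,1]$ for a.e. $t\in[t_0,T]$; and $-1\le x(t)\le 1$ for all $t\in[t_0,T]$. Such a pair $(x,u)$ is called a feasible process. The norm is $\|x\|_{W^{1,1}}=|x(t_0)|+\int_{t_0}^T|\dot x(t)|\,dt$. A feasible process $(\bar x,\bar u)$ is a local solution ($W^{1,1}$ local minimizer) if there is $\delta>0$ with $J(\bar x,\bar u)\le J(x,u)$ for every feasible process $(x,u)$ with $\|\bar x-x\|_{W^{1,1}}\le\delta$; it is a global solution ($W^{1,1}$ global minimizer) if $J(\bar x,\bar u)\le J(x,u)$ for every feasible process $(x,u)$. *)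

(* Defs.v *)
From HB Require Import structures.
From mathcomp Require Import all_boot all_order all_algebra.
From mathcomp Require Import all_classical all_reals all_analysis.

Set Implicit Arguments.
Unset Strict Implicit.
Unset Printing Implicit Defensive.

Import Order.TTheory GRing.Theory Num.Theory.
Import numFieldNormedType.Exports.

Local Open Scope classical_set_scope.
Local Open Scope ring_scope.

(* [lebesgue_measure] in the library lives on the Borel sets, so that its
   measurable functions are the Borel ones. Below, measurability and integrals
   are relative to the completed measure, i.e., to Lebesgue-measurable sets. *)
Definition lebesgue_type (R : realType) :=
  caratheodory_type ((@wlength R idfun)^*)%mu.

Definition Lmeasurable_on (R : realType) (s T : R) (f : R -> R) : Prop :=
  @measurable_fun _ _ (lebesgue_type R) (measurableTypeR R) `[s, T] f.

Definition Lintegral (R : realType) (s T : R) (f : R -> R) : R :=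
  \int[@completed_lebesgue_measure R]_(t in `[s, T]) f t.

Definition ae_on (R : realType) (s T : R) (P : R -> Prop) : Prop :=
  {ae @completed_lebesgue_measure R, forall t : R, s <= t <= T -> P t}.

Definition absolutely_continuous_on (R : realType) (s T : R) (x : R -> R) :
    Prop :=
  forall e : R, 0 < e -> exists2 d : R, 0 < d &
    forall (n : nat) (p q : 'I_n -> R),
      (forall i, [/\ s <= p i, p i <= q i & q i <= T]) ->
      trivIset [set: 'I_n] (fun i => [set` `]p i, q i[]) ->
      \sum_(i < n) (q i - p i) < d ->
      \sum_(i < n) `|x (q i) - x (p i)| < e.

Definition W11_norm (R : realType) (s T : R) (x : R -> R) : R :=
  `|x s| + Lintegral s T (fun t => `|derive1 x t|).

(* States and controls are total functions of which only the restriction to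
   [t0, T] matters. The derivatives in [fp3_feasible] and [W11_norm] are
   two-sided ones, which sees values outside of [t0, T] only at t0 and T. *)
Definition fp3_cost (R : realType) (lambda t0 T : R) (x u : R -> R) : R :=
  Lintegral t0 T (fun t => - (expR (- lambda * t) * (x t + u t))).

Record fp3_feasible (R : realType) (a t0 T x0 : R) (x u : R -> R) : Prop := {
  fp3_state_ac : absolutely_continuous_on t0 T x ;
  fp3_control_measurable : Lmeasurable_on t0 T u ;
  fp3_dynamics : ae_on t0 T (fun t => is_derive t (1 : R) x (- a * u t)) ;
  fp3_initial : x t0 = x0 ;
  fp3_control_constraint : ae_on t0 T (fun t => -1 <= u t <= 1) ;
  fp3_state_constraint : forall t, t0 <= t <= T -> -1 <= x t <= 1
}.

Definition fp3_local_solution (R : realType) (a lambda t0 T x0 : R)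
    (xb ub : R -> R) : Prop :=
  fp3_feasible a t0 T x0 xb ub /\
  exists2 delta : R, 0 < delta &
    forall x u : R -> R, fp3_feasible a t0 T x0 x u ->
      W11_norm t0 T (xb - x) <= delta ->
      fp3_cost lambda t0 T xb ub <= fp3_cost lambda t0 T x u.

Definition fp3_global_solution (R : realType) (a lambda t0 T x0 : R)
    (xb ub : R -> R) : Prop :=
  fp3_feasible a t0 T x0 xb ub /\
  forall x u : R -> R, fp3_feasible a t0 T x0 x u ->
    fp3_cost lambda t0 T xb ub <= fp3_cost lambda t0 T x u.

(* Equality of processes in W^{1,1} x L^0: pointwise for the continuous
   representative x, almost everywhere for the control u. *)
Definition same_process (R : realType) (t0 T : R) (x u y v : R -> R) : Prop :=
  (forall t, t0 <= t <= T -> x t = y t) /\ ae_on t0 T (fun t => u t = v t).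

Definition unique_process (R : realType) (t0 T : R)
    (P : (R -> R) -> (R -> R) -> Prop) (xb ub : R -> R) : Prop :=
  P xb ub /\ forall x u : R -> R, P x u -> same_process t0 T x u xb ub.

(* Main.v *)
Require Import Defs.
From mathcomp Require Import all_boot all_order all_algebra.
From mathcomp Require Import all_classical all_reals all_analysis.
From mathcomp Require Import measurable_realfun.
From mathcomp Require Import lra ring.

Set Implicit Arguments.
Unset Strict Implicit.
Unset Printing Implicit Defensive.

Import Order.TTheory GRing.Theory Num.Theory.
Import numFieldNormedType.Exports.

Local Open Scope classical_set_scope.
Local Open Scope ring_scope.

(** The weight exp (- lambda t) and the dynamics x' = - a u allow the control
to be eliminated: an integration by parts turns the cost of a feasible process
into
  a^-1 (exp (- lambda T) x(T) - exp (- lambda t0) x0)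
    - (1 - lambda / a) * integral of exp (- lambda t) x(t) dt
(fp3_costE). A cheap state is thus large throughout and small at the end. A
feasible state is a-Lipschitz, hence lies below x0 + a (t - t0), below 1, and
below x(T) + a (T - t), and the smallest end value that it can reach is
y = max (-1, x0 - a (T - t0)). The candidate is the upper envelope
  min (x0 + a (t - t0), 1, y + a (T - t))
for this end value (extremal_state). The three formulas of the theorem are its
three possible shapes.

Raising the end value from y to y + d gains at most d in the state, and only
during the last 2 / a units of time, because before that the third branch of
the envelope is at least 1 and the minimum is attained by the other two. The
gain in the weighted integral is therefore at most
  d * exp (- lambda T) (exp (2 lambda / a) - 1) / lambda,
and the condition 2 / a <= rho says exactly that 1 - lambda / a times this does
not outweigh the loss a^-1 exp (- lambda T) d (tail_gain_le, weighted_gap).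
Equality forces the difference of the two states to be equal to d right after
the time at which the last 2 / a units begin (or t0, if this is later), where it
is at most 0; so d = 0, and then the two states agree (extremal_gap).

The cost is affine along segments between feasible processes, and a short
segment is short in the W^{1,1} norm, so that a local solution is a global one
(local_solution_global).

States are only absolutely continuous, so the two facts of real analysis that
the argument rests on concern almost everywhere derivatives. An absolutely
continuous function with derivative nonnegative almost everywhere is
nondecreasing (ae_derive_ge0_le), which makes feasible states Lipschitz; and a Lipschitz
function is the integral of its derivative (Lintegral_lipschitz_derive), which
gives the formula for the cost. *)

(** * Absolutely continuous functions with nonnegative derivative *)

Lemma is_derive_ge0_slope (R : realType) (f : R -> R) (t l e : R) :
    is_derive t (1 : R) f l -> 0 <= l -> 0 < e ->
  exists2 d, 0 < d & forall y z : R, t - d < y <= t -> t <= z < t + d ->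
    - e * (z - y) <= f z - f y.
Proof.
move=> [df fl] l0 e0.
have : (fun h => h^-1 *: ((f \o shift t) (h *: 1) - f t)) @ 0^' --> l.
  by rewrite -fl; exact: df.
move=> /cvgrPdist_lt /(_ e e0) [d /= d0 H]; exists d => //.
have K y : `|t - y| < d -> y != t -> - e < (y - t)^-1 * (f y - f t).
  move=> tyd yt; have := H (y - t).
  rewrite /= sub0r normrN distrC tyd subr_eq0 yt => /(_ isT isT).
  rewrite /= scaler1 subrK.
  rewrite /GRing.scale/=.
  by move=> /(le_lt_trans (ler_norm _)); lra.
move=> y z /andP[ty yt] /andP[tz zt].
have h1 : - e * (z - t) <= f z - f t.
  have [->|zNt] := eqVneq z t; first by lra.
  have zt0 : 0 < z - t by rewrite subr_gt0 lt_neqAle eq_sym zNt.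
  have := K z; rewrite distrC gtr0_norm// => /(_ _ zNt) Hz.
  have : - e < (z - t)^-1 * (f z - f t) by apply: Hz; lra.
  by rewrite mulrC ltr_pdivlMr//; lra.
have h2 : - e * (t - y) <= f t - f y.
  have [->|yNt] := eqVneq y t; first by lra.
  have yt0 : 0 < t - y by rewrite subr_gt0 lt_neqAle yNt.
  have := K y; rewrite gtr0_norm// => /(_ _ yNt) Hz.
  have : - e < (y - t)^-1 * (f y - f t) by apply: Hz; lra.
  rewrite -opprB invrN mulNr -mulrN opprB mulrC ltr_pdivlMr//; lra.
by lra.
Qed.

(** A subdivision of [s, t] by points p 0 <= p 1 <= ... <= p n = t in which
each step [p i, p i.+1] begins with an exceptional part ]p i, q i[ inside U;
outside of the exceptional parts f decreases with slope at most e. With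
p i = q i a step has no exceptional part. The points are indexed by nat rather
than by 'I_n so that a chain can be extended by one step. *)
Definition exceptional_chain (R : realType) (U : set R) (f : R -> R)
    (e s t : R) : Prop :=
  exists n (p q : nat -> R), [/\ p n = t,
    forall i, (i < n)%N -> [/\ s <= p i, p i <= q i, q i <= p i.+1 &
                               `]p i, q i[ `<=` U] &
    - e * (t - s) - \sum_(i < n) `|f (q i) - f (p i)| <= f t - f s].

Lemma exceptional_chain_extend (R : realType) (U : set R) (f : R -> R)
    (e s t t' : R) :
    s <= t -> t <= t' ->
    (- e * (t' - t) <= f t' - f t) \/ `]t, t'[ `<=` U -> 0 < e ->
  exceptional_chain U f e s t -> exceptional_chain U f e s t'.
Proof.
move=> st tt' H e0 [n [p [q [pn pq fts]]]].
have [r [tr rt' rU fr]] : exists r, [/\ t <= r, r <= t', `]t, r[ `<=` U &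
    - e * (t' - t) - `|f r - f t| <= f t' - f t].
  case: H => H.
    exists t; split => //; last by rewrite subrr normr0 subr0.
    by move=> x /=; rewrite in_itv/=; lra.
  exists t'; split => //.
  have := ler_norm (f t - f t'); rewrite distrC.
  have : 0 <= e * (t' - t) by apply: mulr_ge0; lra.
  by lra.
exists n.+1, (fun i => if i == n.+1 then t' else p i),
  (fun i => if i == n then r else q i); split.
- by rewrite eqxx.
- move=> i; rewrite ltnS leq_eqVlt => /predU1P[->|iltn].
    by rewrite !eqxx ltn_eqF// pn; split.
  have -> : (i == n) = false by rewrite ltn_eqF.
  have -> : (i == n.+1) = false by rewrite ltn_eqF// ltnW.
  have -> : (i.+1 == n.+1) = false by rewrite ltn_eqF.
  exact: pq.
- rewrite big_ord_recr/= !eqxx ltn_eqF// pn.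
  rewrite (eq_bigr (fun i : 'I_n => `|f (q i) - f (p i)|)) => [|i _].
    by lra.
  have -> : (i == n :> nat) = false by rewrite ltn_eqF.
  by have -> : (i == n.+1 :> nat) = false by rewrite ltn_eqF// ltnS ltnW.
Qed.

(** The exceptional parts are disjoint and lie in U, so their total length is
less than d and absolute continuity bounds what f loses on them. *)
Lemma exceptional_chain_le (R : realType) (U : set R) (f : R -> R)
    (e d s T : R) : 0 < e ->
    (forall (n : nat) (p q : 'I_n -> R),
      (forall i, [/\ s <= p i, p i <= q i & q i <= T]) ->
      trivIset [set: 'I_n] (fun i => [set` `]p i, q i[]) ->
      \sum_(i < n) (q i - p i) < d ->
      \sum_(i < n) `|f (q i) - f (p i)| < e) ->
    open U -> (lebesgue_measure U < d%:E)%E ->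
  exceptional_chain U f e s T -> - e * (T - s) - e <= f T - f s.
Proof.
move=> e0 fe oU Ud [n [p [q [pn pq fts]]]].
have pmono i j : (i <= j <= n)%N -> p i <= p j.
  move=> /andP[]; elim: j => [|j IH]; first by rewrite leqn0 => /eqP ->.
  rewrite leq_eqVlt => /predU1P[-> //|]; rewrite ltnS => ij jn.
  have [_ pqj qpj _] := pq j jn.
  by rewrite (le_trans (IH ij (ltnW jn)))// (le_trans pqj).
have qp i j : (i < j)%N -> (j <= n)%N -> q i <= p j.
  move=> ij jn; have [//|_ _ ? _] := pq i; first exact: (leq_trans ij).
  by rewrite (le_trans _ (pmono i.+1 j _))// ij.
have tI : trivIset [set: 'I_n] (fun i => [set` `]p i, q i[]).
  apply/trivIsetP => /= i j _ _; rewrite -val_eqE/= => ij.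
  rewrite -subset0 => x /= [].
  rewrite !in_itv/= => /andP[pix xqi] /andP[pjx xqj].
  have [ltij|ltji|] := ltngtP i j.
  - by have := qp _ _ ltij (ltnW (ltn_ord j)); lra.
  - by have := qp _ _ ltji (ltnW (ltn_ord i)); lra.
  - by move/eqP; rewrite (negbTE ij).
suff : \sum_(i < n) `|f (q i) - f (p i)| < e by lra.
apply: (fe n) => //.
- move=> i; have [? ? ? ?] := pq i (ltn_ord i); split => //.
  by rewrite -pn qp.
- have lenE (i : 'I_n) :
      (lebesgue_measure `]p i, q i[%classic = (q i - p i)%:E)%E.
    have [_ + _ _] := pq i (ltn_ord i).
    rewrite lebesgue_measure_itv/= lte_fin le_eqVlt => /predU1P[->|->].
      by rewrite ltxx subrr.
    by rewrite -EFinB.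
  rewrite -lte_fin -sumEFin; apply: le_lt_trans Ud.
  under eq_bigr => i _ do rewrite -lenE.
  rewrite -measure_semi_additive_ord//=; last first.
  + by apply: bigsetU_measurable => i _; exact: measurable_itv.
  + rewrite le_measure ?inE//.
    * by apply: bigsetU_measurable => i _; exact: measurable_itv.
    * exact: open_measurable.
    * apply: (@big_ind _ (fun A => A `<=` U)) => //.
        by move=> A B AU BU; rewrite subUset.
      by move=> i _; case: (pq i (ltn_ord i)).
Qed.

(** The null set of bad points is covered by an open set U of small measure.
Every point of [s, T] has a neighborhood in which chains can be prolonged,
either because f has a nonnegative derivative there or because the neighborhood
lies in U; so the supremum of the points reached by a chain is T. *)
Lemma ae_derive_ge0_le (R : realType) (s T : R) (f : R -> R) : s <= T ->
    absolutely_continuous_on s T f ->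
    ae_on s T (fun t => exists2 l, 0 <= l & is_derive t (1 : R) f l) ->
  f s <= f T.
Proof.
move=> sT acf [N [mN N0 subN]].
suff key e : 0 < e -> - e * (T - s) - e <= f T - f s.
  rewrite -subr_ge0; rewrite leNgt; apply/negP => fTs.
  have := key ((f s - f T) / (2 * (T - s + 1))).
  set e := _ / _.
  have e0 : 0 < e by rewrite divr_gt0//; lra.
  move=> /(_ e0).
  have -> : - e * (T - s) - e = - ((f s - f T) / 2).
    by rewrite /e; field; apply/eqP; lra.
  by lra.
move=> e0; have [d d0 fd] := acf e e0.
have [U [oU NU Ud]] : exists U : set R,
    [/\ open U, N `<=` U & (lebesgue_measure U < d%:E)%E].
  have d20 : 0 < d / 2 by lra.
  have [U [oU NU Ud]] := @outer_measure_open_le R N _ d20.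
  exists U; split => //; apply: (le_lt_trans Ud).
  rewrite [X in (X + _)%E](_ : _ = 0%E); last exact: N0.
  by rewrite add0e lte_fin; lra.
apply: (exceptional_chain_le e0 fd oU Ud).
pose A := [set t | s <= t <= T /\ exceptional_chain U f e s t].
have As : A s.
  split; first by lra.
  by exists 0%N, (fun=> s), (fun=> s); split => //; rewrite big_ord0; lra.
have hsA : has_sup A by split; [exists s|exists T => t [/andP[]]].
pose c := sup A.
have sc : s <= c by apply: ub_le_sup => //; case: hsA.
have cT : c <= T by apply: sup_le_ub; [exists s|move=> t [/andP[]]].
have [r r0 Hr] : exists2 r, 0 < r & forall y z : R, c - r < y <= c ->
    c <= z < c + r -> (- e * (z - y) <= f z - f y) \/ `]y, z[ `<=` U.
  have [cU|cNU] := pselect (U c).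
    have /nbhs_ballP[r /= r0 rU] : nbhs c U by apply: open_nbhs_nbhs.
    exists r => // y z yc cz; right => x /=; rewrite in_itv/= => xyz.
    by apply: rU; rewrite /ball/= ltr_norml; lra.
  have [l l0 fl] : exists2 l, 0 <= l & is_derive c (1 : R) f l.
    have : ~ (~` [set t : R | s <= t <= T -> exists2 l, 0 <= l &
        is_derive t (1 : R) f l]) c by move=> /subN /NU.
    by move=> /= /contrapT; apply; rewrite sc cT.
  have [r r0 Hr] := is_derive_ge0_slope fl l0 e0.
  by exists r => // y z yc cz; left; apply: Hr.
have [y yA] := sup_adherent r0 hsA; rewrite -/c => cry.
have yc : y <= c by apply: ub_le_sup => //; case: hsA.
have yAsT : s <= y <= T by case: yA.
pose z := Num.min T (c + r / 2).
have zT : z <= T by rewrite ge_min lexx.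
have zr : z <= c + r / 2 by rewrite ge_min lexx orbT.
have cz : c <= z by rewrite le_min cT/=; lra.
have zA : A z.
  split; first by lra.
  apply: (@exceptional_chain_extend _ _ _ _ _ y) => //; try lra.
  - by apply: Hr; lra.
  - by case: yA.
have : z <= c by apply: ub_le_sup => //; case: hsA.
rewrite ge_min => /orP[Tc|]; last by lra.
have -> : T = z by lra.
by case: zA.
Qed.

(** * Almost everywhere statements and Lipschitz functions *)

Lemma ae_completed_filter (R : realType) :
  Filter (nbhs (almost_everywhere (@completed_lebesgue_measure R))).
Proof.
exact: (ae_filter_ringOfSetsType (@completed_lebesgue_measure R)).
Qed.

Lemma ae_onS (R : realType) (s T : R) (P Q : R -> Prop) :
  (forall t : R, s <= t <= T -> P t -> Q t) -> ae_on s T P -> ae_on s T Q.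
Proof.
move=> PQ; apply: (@filterS _ _ (ae_completed_filter R)) => t Pt st.
exact: PQ (Pt st).
Qed.

Lemma ae_onS2 (R : realType) (s T : R) (P1 P2 Q : R -> Prop) :
  (forall t : R, s <= t <= T -> P1 t -> P2 t -> Q t) ->
  ae_on s T P1 -> ae_on s T P2 -> ae_on s T Q.
Proof.
move=> PQ; apply: (@filterS2 _ _ (ae_completed_filter R)) => t P1t P2t st.
exact: PQ (P1t st) (P2t st).
Qed.

Lemma ae_on_subitv (R : realType) (s T s' T' : R) (P : R -> Prop) :
  s <= s' -> T' <= T -> ae_on s T P -> ae_on s' T' P.
Proof.
move=> ss' TT'.
apply: (@filterS _ _ (ae_completed_filter R)) => t Pt /andP[st tT].
by apply: Pt; lra.
Qed.

Lemma completed_lebesgue_measure_set1 (R : realType) (c : R) :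
  (@completed_lebesgue_measure R).-negligible [set c].
Proof.
exists [set c]; split => //.
- by apply: sub_caratheodory; exact: (@measurable_set1 R).
- exact: (@lebesgue_measure_set1 R c).
Qed.

Lemma ae_on_neq (R : realType) (s T c : R) : ae_on s T (fun t => t != c).
Proof.
have [N [mN N0 cN]] := completed_lebesgue_measure_set1 c.
exists N; split => // t /= H; apply: cN => /=.
by apply: contra_notP H => /eqP.
Qed.

Definition lipschitz_itv (R : realType) (s T L : R) (f : R -> R) :=
  forall y z : R, s <= y -> y <= z -> z <= T -> `|f z - f y| <= L * (z - y).

Lemma absolutely_continuous_subitv (R : realType) (s T s' T' : R)
    (f : R -> R) : s <= s' -> T' <= T ->
  absolutely_continuous_on s T f -> absolutely_continuous_on s' T' f.
Proof.
move=> ss' TT' acf e e0; have [d d0 H] := acf e e0; exists d => // n p q pq.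
apply: H => i; have [? ? ?] := pq i; split => //; lra.
Qed.

Lemma lipschitz_absolutely_continuous (R : realType) (s T L : R)
    (f : R -> R) : lipschitz_itv s T L f -> absolutely_continuous_on s T f.
Proof.
move=> Lf e e0; exists (e / (`|L| + 1)).
  by rewrite divr_gt0// ltr_wpDl.
move=> n p q pq _; rewrite ltr_pdivlMr; last by rewrite ltr_wpDl.
apply: le_lt_trans; rewrite mulr_suml; apply: ler_sum => i _.
have [spi pqi qiT] := pq i.
apply: (le_trans (Lf _ _ spi pqi qiT)); rewrite mulrC.
by rewrite ler_wpM2l ?subr_ge0//; have := ler_norm L; lra.
Qed.

Lemma absolutely_continuousD (R : realType) (s T : R) (f g : R -> R) :
    absolutely_continuous_on s T f -> absolutely_continuous_on s T g ->
  absolutely_continuous_on s T (fun t => f t + g t).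
Proof.
move=> acf acg e e0; have e20 : 0 < e / 2 by lra.
have [d1 d10 H1] := acf _ e20; have [d2 d20 H2] := acg _ e20.
exists (Num.min d1 d2); first by rewrite lt_min d10.
move=> n p q pq tI; rewrite lt_min => /andP[pqd1 pqd2].
have := H1 n p q pq tI pqd1; have := H2 n p q pq tI pqd2.
suff : \sum_(i < n) `|f (q i) + g (q i) - (f (p i) + g (p i))| <=
    \sum_(i < n) `|f (q i) - f (p i)| + \sum_(i < n) `|g (q i) - g (p i)|.
  by lra.
rewrite -big_split/=; apply: ler_sum => i _.
by rewrite (le_trans _ (ler_normD _ _))// opprD addrACA.
Qed.

Lemma absolutely_continuousN (R : realType) (s T : R) (f : R -> R) :
  absolutely_continuous_on s T f ->
  absolutely_continuous_on s T (fun t => - f t).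
Proof.
move=> acf e e0; have [d d0 H] := acf e e0; exists d => // n p q pq tI pqd.
under eq_bigr => i _ do rewrite -opprD normrN.
exact: H.
Qed.

(** Both L t + f t and L t - f t have a nonnegative derivative almost
everywhere. *)
Lemma ae_derive_le_lipschitz (R : realType) (s T L : R) (f : R -> R) :
    absolutely_continuous_on s T f ->
    ae_on s T (fun t => exists2 l, `|l| <= L & is_derive t (1 : R) f l) ->
  lipschitz_itv s T L f.
Proof.
move=> acf df y z sy yz zT.
have acL : absolutely_continuous_on y z (fun t => L * t).
  apply: (@lipschitz_absolutely_continuous _ _ _ `|L|) => p q _ pq _.
  by rewrite -mulrBr normrM (ger0_norm (_ : 0 <= q - p))// subr_ge0.
have acf' := absolutely_continuous_subitv sy zT acf.
have df' := ae_on_subitv sy zT df.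
have dL t : is_derive t (1 : R) (fun t => L * t) L.
  apply: is_derive_eq (is_deriveZ L (is_derive_id t 1)) _.
  by rewrite [LHS]mulr1.
have : L * y + f y <= L * z + f z.
  apply: (ae_derive_ge0_le yz (absolutely_continuousD acL acf')).
  apply: ae_onS df' => t _ [l lL fl]; exists (L + l); last exact: is_deriveD.
  by move: lL; rewrite ler_norml; lra.
have : L * y - f y <= L * z - f z.
  apply: (ae_derive_ge0_le yz
    (absolutely_continuousD acL (absolutely_continuousN acf'))).
  apply: ae_onS df' => t _ [l lL fl]; exists (L - l); last exact: is_deriveB.
  by move: lL; rewrite ler_norml; lra.
by rewrite ler_norml; lra.
Qed.

(** * Derivatives, primitives and the completed Lebesgue measure *)

Lemma is_derive_mull (R : realType) (f : R -> R) (k t l : R) :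
  is_derive t (1 : R) f l -> is_derive t (1 : R) (fun y => k * f y) (k * l).
Proof. by move=> fl; apply: is_derive_eq (is_deriveZ k fl) _. Qed.

Lemma is_derive_mul (R : realType) (f g : R -> R) (t df dg : R) :
    is_derive t (1 : R) f df -> is_derive t (1 : R) g dg ->
  is_derive t (1 : R) (fun y => f y * g y) (f t * dg + g t * df).
Proof. by move=> fl gl; apply: is_derive_eq (is_deriveM fl gl) _. Qed.

Lemma is_derive_add (R : realType) (f g : R -> R) (t df dg : R) :
    is_derive t (1 : R) f df -> is_derive t (1 : R) g dg ->
  is_derive t (1 : R) (fun y => f y + g y) (df + dg).
Proof. by move=> fl gl; apply: is_derive_eq (is_deriveD fl gl) _. Qed.

Lemma is_derive_sub (R : realType) (f g : R -> R) (t df dg : R) :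
    is_derive t (1 : R) f df -> is_derive t (1 : R) g dg ->
  is_derive t (1 : R) (fun y => f y - g y) (df - dg).
Proof. by move=> fl gl; apply: is_derive_eq (is_deriveB fl gl) _. Qed.

Lemma is_derive_continuous (R : realType) (f : R -> R) (t l : R) :
  is_derive t (1 : R) f l -> {for t, continuous f}.
Proof. by move=> [df _]; exact/differentiable_continuous/derivable1_diffP. Qed.

Lemma is_derive_cvg_seq (R : realType) (f : R -> R) (t l : R) :
    is_derive t (1 : R) f l ->
  n.+1%:R * (f (t + n.+1%:R^-1) - f t) @[n --> \oo] --> l.
Proof.
move=> [df fl].
have : (fun h => h^-1 *: ((f \o shift t) (h *: 1) - f t)) @ 0^' --> l.
  by rewrite -fl; exact: df.
move=> /cvgrPdist_lt H; apply/cvgrPdist_lt => e e0.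
have [d /= d0 {}H] := H e e0.
have : \forall n \near \oo, (n.+1%:R^-1 : R) < d.
  exact: near_infty_natSinv_lt (PosNum d0).
apply: filterS => n nd; have := H n.+1%:R^-1.
rewrite /= sub0r normrN gtr0_norm ?invr_gt0// invr_eq0 pnatr_eq0 => /(_ nd isT).
by rewrite invrK scaler1 [_ + t]addrC.
Qed.

Lemma continuous_primitive (R : realType) (f : R -> R) (a : R) :
  continuous f -> exists F : R -> R,
    forall t : R, a < t -> is_derive t (1 : R) F (f t).
Proof.
move=> cf.
exists (fun t => \int[@lebesgue_measure R]_(x in `[a, t]) f x) => t at_.
have t1 : t < t + 1 by rewrite ltrDl.
have intf : (@lebesgue_measure R).-integrable `[a, t + 1] (EFin \o f).
  apply: continuous_compact_integrable; first exact: segment_compact.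
  exact: continuous_subspaceT.
have [dF <-] := continuous_FTC1_closed t1 intf at_ (cf t).
by rewrite derive1E; exact: DeriveDef.
Qed.

Lemma continuous_Lmeasurable (R : realType) (f : R -> R) (s T : R) :
  continuous f -> Lmeasurable_on s T f.
Proof.
move=> /continuous_measurable_fun mf mD B mB; apply: sub_caratheodory.
by apply: (measurable_funTS mf).
Qed.

Lemma completed_lebesgue_measure_itv (R : realType) (s T : R) : s <= T ->
  @completed_lebesgue_measure R `[s, T] = (T - s)%:E.
Proof.
move=> sT; transitivity (@lebesgue_measure R `[s, T]%classic) => //.
rewrite lebesgue_measure_itv/= lte_fin; move: sT; rewrite le_eqVlt.
by move=> /predU1P[->|->]; rewrite ?ltxx ?subrr// -EFinB.
Qed.

Lemma bounded_completed_integrable (R : realType) (f : R -> R) (s T M : R) :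
    s <= T -> Lmeasurable_on s T f ->
    (forall t : R, s <= t <= T -> `|f t| <= M) ->
  (@completed_lebesgue_measure R).-integrable `[s, T] (EFin \o f).
Proof.
move=> sT mf fM; apply: measurable_bounded_integrable => //.
- by apply: sub_caratheodory; exact: measurable_itv.
- by rewrite [X in (X < _)%E](completed_lebesgue_measure_itv sT) ltry.
- exists M; split; first exact: num_real.
  move=> x Mx t /=; rewrite in_itv/= => st.
  by rewrite (le_trans (fM t st))// ltW.
Qed.

(** The identity from Lebesgue measurable to Borel sets is measurable, and it
pushes the completed measure forward to the Borel one. *)
Lemma completed_integral_continuous (R : realType) (f : R -> R) (s T M : R) :
    s <= T -> continuous f -> (forall t : R, s <= t <= T -> `|f t| <= M) ->
  (\int[@completed_lebesgue_measure R]_(t in `[s, T]) (f t)%:E =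
   \int[@lebesgue_measure R]_(t in `[s, T]) (f t)%:E)%E.
Proof.
move=> sT cf fM.
have mid : @measurable_fun _ _ (lebesgue_type R) (measurableTypeR R) setT idfun.
  by move=> _ B mB; rewrite setTI; exact: sub_caratheodory.
have mg := (measurable_EFinP _ _).2
  (continuous_measurable_fun cf).
have intf := bounded_completed_integrable sT (continuous_Lmeasurable cf) fM.
have mI : measurable (`[s, T] : set (measurableTypeR R)).
  exact: measurable_itv.
have := @integral_pushforward _ _ _ _ R _ mid
  (@completed_lebesgue_measure R) _ (EFin \o f) mg intf mI.
by move=> <-; apply: eq_measure_integral.
Qed.

(** * A Lipschitz function is the integral of its derivative *)

(** Outside of [s, T] the function is continued by its end values. The constant
becomes `|L| because L may be negative when s = T. *)
Lemma lipschitz_extension (R : realType) (f : R -> R) (s T L : R) :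
    s <= T -> lipschitz_itv s T L f -> exists F : R -> R,
  [/\ forall t : R, s <= t <= T -> F t = f t,
      continuous F &
      forall y z : R, y <= z -> `|F z - F y| <= `|L| * (z - y)].
Proof.
move=> sT Lf; pose F t := f (Num.max s (Num.min T t)).
have clampE t : s <= t <= T -> Num.max s (Num.min T t) = t.
  by move=> /andP[st tT]; rewrite min_r// max_r.
have clamp_itv t : s <= Num.max s (Num.min T t) <= T.
  by rewrite le_max lexx/= ge_max sT ge_min lexx.
have FL y z : y <= z -> `|F z - F y| <= `|L| * (z - y).
  move=> yz.
  have [cyz dyz] : Num.max s (Num.min T y) <= Num.max s (Num.min T z) /\
      Num.max s (Num.min T z) - Num.max s (Num.min T y) <= z - y.
    by rewrite !maxEle !minEle; repeat case: ifP; lra.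
  have /andP[sy yT] := clamp_itv y; have /andP[sz zT] := clamp_itv z.
  apply: (le_trans (Lf _ _ sy cyz zT)).
  apply: (@le_trans _ _
      (`|L| * (Num.max s (Num.min T z) - Num.max s (Num.min T y)))).
    by rewrite ler_wpM2r ?subr_ge0// ler_norm.
  by rewrite ler_wpM2l.
exists F; split => //; first by move=> t st; rewrite /F clampE.
move=> t; apply/cvgrPdist_lt => e e0.
exists (e / (`|L| + 1)) => /=; first by rewrite divr_gt0// ltr_wpDl.
move=> y /=; rewrite ltr_pdivlMr; last by rewrite ltr_wpDl.
apply: le_lt_trans; apply: (@le_trans _ _ (`|L| * `|t - y|)); last first.
  by rewrite mulrC ler_wpM2l//; lra.
have [ty|/ltW yt] := leP t y.
  by rewrite distrC (distrC t) (@ger0_norm _ (y - t)) ?subr_ge0//; exact: FL.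
by rewrite (@ger0_norm _ (t - y)) ?subr_ge0//; exact: FL.
Qed.

(** By dominated convergence the integral of g is the limit of the integrals of
the difference quotients of h with step 1 / (n + 1), which are bounded by the
Lipschitz constant. Those quotients are continuous, and the same quotients of a
primitive of h are their primitives; these converge at s and T to h. *)
Lemma Lintegral_lipschitz_derive (R : realType) (s T L : R) (h g : R -> R) :
    s < T -> lipschitz_itv s T L h -> Lmeasurable_on s T g ->
    ae_on s T (fun t => is_derive t (1 : R) h (g t)) ->
  Lintegral s T g = h T - h s.
Proof.
move=> sT Lh mg dh.
have [h' [h'E ch' Lh']] := lipschitz_extension (ltW sT) Lh.
have [H dH] := continuous_primitive (s - 1) ch'.
have {dh}dh' : ae_on s T (fun t => is_derive t (1 : R) h' (g t)).
  have : ae_on s T (fun t => t != s /\ t != T).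
    by apply: ae_onS2 (ae_on_neq s T s) (ae_on_neq s T T).
  apply: ae_onS2 dh => t st dh [ts tT].
  apply: near_eq_is_derive dh.
  have : t \in `]s, T[.
    rewrite in_itv/=; move: st.
    by rewrite !le_eqVlt eq_sym (negbTE ts) (negbTE tT).
  move=> /near_in_itvoo; apply: filterS => y /=.
  by rewrite in_itv/= => yi; rewrite h'E//; lra.
pose q n t := n.+1%:R * (h' (t + n.+1%:R^-1) - h' t).
pose K n t := n.+1%:R * (H (t + n.+1%:R^-1) - H t).
have n0 n : 0 < n.+1%:R^-1 :> R by rewrite invr_gt0.
have cq n : continuous (q n).
  move=> t; apply: cvgM; first exact: cvg_cst.
  apply: cvgB; last exact: ch'.
  apply: continuous_cvg; first exact: ch'.
  by apply: cvgD; [exact: cvg_id|exact: cvg_cst].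
have qL n t : `|q n t| <= `|L|.
  rewrite /q normrM (@ger0_norm _ n.+1%:R)// mulrC -ler_pdivlMr//.
  have tn : t <= t + n.+1%:R^-1 by rewrite lerDl ltW.
  by rewrite (le_trans (Lh' _ _ tn))// addrC addKr.
have dK n t : s <= t -> is_derive t (1 : R) (K n) (q n t).
  move=> st; apply/is_derive_mull/is_derive_sub; last by apply: dH; lra.
  have dshift : is_derive t (1 : R) (fun t => t + n.+1%:R^-1) (1 + 0).
    exact: is_derive_add.
  rewrite -[h' _]mulr1 -[X in _ * X]addr0.
  apply: (@is_derive1_comp _ H _ _ _ _ _ dshift).
  by apply: dH => /=; move: (n.+1%:R^-1) (n0 n) => c c0; lra.
have intq n : (\int[@completed_lebesgue_measure R]_(t in `[s, T]) (q n t)%:E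
    = (K n T - K n s)%:E)%E.
  rewrite (completed_integral_continuous (ltW sT) (cq n) (fun t _ => qL n t)).
  rewrite (@continuous_FTC2 _ _ (K n))//.
  - exact: continuous_subspaceT.
  - split.
    + by move=> t; rewrite in_itv/= => /andP[/ltW/(dK n)[]].
    + by apply/cvg_at_right_filter/(is_derive_continuous (dK n s _)).
    + by apply/cvg_at_left_filter/(is_derive_continuous (dK n T _)); exact: ltW.
  - move=> t; rewrite in_itv/= => /andP[/ltW/(dK n)[_ + _]].
    by rewrite derive1E.
have Kcvg t : s <= t -> K n t @[n --> \oo] --> h' t.
  by move=> st; apply/is_derive_cvg_seq/dH; lra.
have [] := @dominated_convergence _ _ _ (@completed_lebesgue_measure R) `[s, T]
  _ (fun n => EFin \o q n) (EFin \o g) (cst `|L|%:E).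
- by apply: sub_caratheodory; exact: measurable_itv.
- move=> n; apply/measurable_EFinP; exact: continuous_Lmeasurable.
- exact/measurable_EFinP.
- apply: (@filterS _ _ (ae_completed_filter R)) dh' => t dht.
  rewrite /= in_itv/= => st; apply: cvg_EFin; first by near=> n.
  exact: is_derive_cvg_seq (dht st).
- apply: (@bounded_completed_integrable _ (cst `|L|) _ _ `|L|) => //.
  + exact: ltW.
  + exact: measurable_cst.
  + by move=> t _; rewrite normr_id.
- by apply: aeW => t n _; rewrite /= lee_fin.
move=> _ _; under eq_fun => n do rewrite intq.
move=> cvgg; rewrite /Lintegral /Rintegral.
have cvgK : (K n T - K n s)%:E @[n --> \oo] --> (h' T - h' s)%:E.
  by apply: cvg_EFin; [near=> n|apply: cvgB; apply: Kcvg => //; exact: ltW].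
rewrite -(cvg_lim _ cvgg)// (cvg_lim _ cvgK)//= !h'E//; lra.
Unshelve. all: by end_near.
Qed.

(** * Consequences of the mean value theorem *)

Lemma derive_within_continuous (R : realType) (F f : R -> R) (s T : R) :
    (forall t : R, s <= t <= T -> is_derive t (1 : R) F (f t)) ->
  {within `[s, T], continuous F}.
Proof.
move=> dF; apply: continuous_in_subspaceT => t.
by rewrite inE/= in_itv/= => /dF; exact: is_derive_continuous.
Qed.

Lemma derive_le0_le (R : realType) (F f : R -> R) (s T : R) : s <= T ->
    (forall t : R, s <= t <= T -> is_derive t (1 : R) F (f t)) ->
    (forall t : R, s <= t <= T -> f t <= 0) ->
  F T <= F s.
Proof.
move=> sT dF f0.
have [||c] := @MVT_segment _ F f s T sT.
- by move=> t; rewrite in_itv/= => st; apply: dF; lra.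
- exact: derive_within_continuous dF.
rewrite in_itv/= => /f0 fc0 FTs.
have : f c * (T - s) <= 0 by rewrite mulr_le0_ge0// subr_ge0.
by lra.
Qed.

(** F decreases but does not end below its initial value, so it is constant. *)
Lemma derive_le0_eq0 (R : realType) (F f : R -> R) (s T : R) :
    (forall t : R, s <= t <= T -> is_derive t (1 : R) F (f t)) ->
    (forall t : R, s <= t <= T -> f t <= 0) -> F s <= F T ->
  forall t : R, s < t < T -> f t = 0.
Proof.
move=> dF f0 FsT t st.
have Fcst y : s <= y <= T -> F y = F s.
  move=> sy; apply/eqP; rewrite eq_le.
  have -> : F y <= F s.
    by apply: (derive_le0_le _ (f := f)) => [|z zy|z zy];
      [lra|apply: dF|apply: f0]; lra.
  rewrite (le_trans FsT)//.
  by apply: (derive_le0_le _ (f := f)) => [|z zy|z zy];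
      [lra|apply: dF|apply: f0]; lra.
have : is_derive t (1 : R) F (f t) by apply: dF; lra.
have : is_derive t (1 : R) F 0.
  apply: (near_eq_is_derive _ (is_derive_cst (F s) t 1)).
  have : t \in `]s, T[ by rewrite in_itv/=.
  move=> /near_in_itvoo; apply: filterS => y /=.
  by rewrite in_itv/= => yi; rewrite Fcst//; lra.
by move=> [_ <-] [_ <-].
Qed.

Lemma derive_lipschitz (R : realType) (F f : R -> R) (s T L : R) :
    (forall t : R, s <= t <= T -> is_derive t (1 : R) F (f t)) ->
    (forall t : R, s <= t <= T -> `|f t| <= L) ->
  lipschitz_itv s T L F.
Proof.
move=> dF fL y z sy yz zT.
have [||c] := @MVT_segment _ F f y z yz.
- by move=> t; rewrite in_itv/= => st; apply: dF; lra.
- by apply: (derive_within_continuous (f := f)) => t st; apply: dF; lra.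
rewrite in_itv/= => yc ->.
rewrite normrM (@ger0_norm _ (z - y)) ?subr_ge0//.
by rewrite ler_wpM2r ?subr_ge0//; apply: fL; lra.
Qed.

Lemma lipschitz_itvB (R : realType) (s T L1 L2 : R) (f g : R -> R) :
    lipschitz_itv s T L1 f -> lipschitz_itv s T L2 g ->
  lipschitz_itv s T (L1 + L2) (fun t => f t - g t).
Proof.
move=> Lf Lg y z sy yz zT.
have := Lf y z sy yz zT; have := Lg y z sy yz zT.
have := ler_normB (f z - f y) (g z - g y).
rewrite (_ : f z - f y - (g z - g y) = f z - g z - (f y - g y)); first by lra.
by ring.
Qed.

Lemma lipschitz_itvZ (R : realType) (s T L k : R) (f : R -> R) :
  lipschitz_itv s T L f -> lipschitz_itv s T (`|k| * L) (fun t => k * f t).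
Proof.
move=> Lf y z sy yz zT; rewrite -mulrBr normrM -mulrA ler_wpM2l//.
exact: Lf.
Qed.

Lemma lipschitz_itvM (R : realType) (s T L1 L2 M1 M2 : R) (f g : R -> R) :
    lipschitz_itv s T L1 f -> lipschitz_itv s T L2 g ->
    (forall t : R, s <= t <= T -> `|f t| <= M1) ->
    (forall t : R, s <= t <= T -> `|g t| <= M2) ->
  lipschitz_itv s T (M1 * L2 + M2 * L1) (fun t => f t * g t).
Proof.
move=> Lf Lg fM gM y z sy yz zT.
rewrite (_ : f z * g z - f y * g y = f z * (g z - g y) + g y * (f z - f y)).
  rewrite (le_trans (ler_normD _ _))// !normrM mulrDl -!mulrA.
  by apply: lerD; apply: ler_pM => //;
    [apply: fM; lra|exact: Lg|apply: gM; lra|exact: Lf].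
by ring.
Qed.

Lemma is_derive_expRMl (R : realType) (k t : R) :
  is_derive t (1 : R) (fun y => expR (k * y)) (k * expR (k * t)).
Proof.
apply: is_derive_eq (@is_derive1_comp _ expR (fun y => k * y) t _ _
  (is_derive_expR _) (is_derive_mull k (is_derive_id t 1))) _.
by rewrite mulr1 mulrC.
Qed.

(** * The cost without the control *)

Lemma feasible_lipschitz (R : realType) (a t0 T x0 : R) (x u : R -> R) :
  0 < a -> fp3_feasible a t0 T x0 x u -> lipschitz_itv t0 T a x.
Proof.
move=> a0 [acx _ dx _ u1 _]; apply: (ae_derive_le_lipschitz acx).
apply: ae_onS2 dx u1 => t _ dxt ut; exists (- a * u t) => //.
rewrite mulNr normrN normrM (gtr0_norm a0) -[leRHS]mulr1.
by rewrite ler_pM2l// ler_norml.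
Qed.

Lemma weighted_primitive (R : realType) (lambda s T L : R) (x : R -> R) :
    s <= T -> lipschitz_itv s T L x -> exists P : R -> R,
  forall t : R, s <= t <= T ->
    is_derive t (1 : R) P (expR (- lambda * t) * x t).
Proof.
move=> sT Lx; have [y [yE cy _]] := lipschitz_extension sT Lx.
have cf : continuous (fun t => expR (- lambda * t) * y t).
  move=> t; apply: cvgM; last exact: cy.
  exact: is_derive_continuous (is_derive_expRMl (- lambda) t).
have [P dP] := continuous_primitive (s - 1) cf.
exists P => t st; rewrite -yE//; apply: dP; lra.
Qed.

(** The right-hand side is the increment over [t0, T] of
a^-1 exp (- lambda t) x(t) - (1 - lambda / a) P(t), and replacing x' by - a u in
the derivative of that Lipschitz function gives the integrand of the cost. *)
Lemma fp3_costE (R : realType) (a lambda t0 T x0 : R) (x u P : R -> R) :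
    0 < lambda -> 0 < a -> 0 <= t0 -> t0 < T -> fp3_feasible a t0 T x0 x u ->
    (forall t : R, t0 <= t <= T ->
      is_derive t (1 : R) P (expR (- lambda * t) * x t)) ->
  fp3_cost lambda t0 T x u =
    a^-1 * (expR (- lambda * T) * x T - expR (- lambda * t0) * x0) -
    (1 - lambda / a) * (P T - P t0).
Proof.
move=> l0 a0 t00 t0T fx dP.
have Lx := feasible_lipschitz a0 fx.
case: fx => _ mu dx <- u1 x1.
pose w t := expR (- lambda * t).
have w1 t : t0 <= t <= T -> `|w t| <= 1.
  move=> st; rewrite ger0_norm ?expR_ge0// -expR0 ler_expR mulNr oppr_le0.
  by apply: mulr_ge0; lra.
have Lw : lipschitz_itv t0 T lambda w.
  apply: (derive_lipschitz (f := fun t => - lambda * w t)) => t st.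
    exact: is_derive_expRMl.
  rewrite normrM normrN (gtr0_norm l0) -[leRHS]mulr1.
  by rewrite ler_pM2l// w1.
have Lwx : lipschitz_itv t0 T (1 * a + 1 * lambda) (fun t => w t * x t).
  by apply: lipschitz_itvM => // t /x1; rewrite ler_norml.
have LP : lipschitz_itv t0 T 1 P.
  apply: (derive_lipschitz dP) => t st; rewrite normrM -[leRHS]mulr1.
  by apply: ler_pM => //; [exact: w1|rewrite ler_norml; exact: x1].
pose h t := a^-1 * (w t * x t) - (1 - lambda / a) * P t.
have Lh := lipschitz_itvB (lipschitz_itvZ a^-1 Lwx)
  (lipschitz_itvZ (1 - lambda / a) LP).
rewrite /fp3_cost (Lintegral_lipschitz_derive t0T Lh) /=.
- by rewrite /w; ring.
- have [y [yE cy _]] := lipschitz_extension (ltW t0T) Lx.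
  have mwy : Lmeasurable_on t0 T (fun t => - w t).
    apply: continuous_Lmeasurable => t; apply: cvgN.
    exact: is_derive_continuous (is_derive_expRMl (- lambda) t).
  apply: (@eq_measurable_fun _ _ (lebesgue_type R) (measurableTypeR R) `[t0, T]
    (fun t => (- w t) * (y t + u t))).
    by move=> t; rewrite inE/= in_itv/= => st; rewrite yE// mulNr.
  apply: measurable_funM => //; apply: measurable_funD => //.
  exact: continuous_Lmeasurable.
- apply: ae_onS dx => t st dxt.
  apply: is_derive_eq (is_derive_sub (is_derive_mull a^-1
    (is_derive_mul (is_derive_expRMl (- lambda) t) dxt))
    (is_derive_mull (1 - lambda / a) (dP t st))) _.
  by field; rewrite gt_eqF.
Qed.

(** * Comparison of two states with weighted integrals *)

(** What d gains on [ts, T] under the weight, against what it costs at T. The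
hypothesis on T - ts is lambda (T - ts) <= ln (a / (a - lambda)) in
exponential form. *)
Lemma tail_gain_le (R : realType) (a lambda ts T d : R) :
    0 < lambda -> lambda < a -> 0 <= d ->
    (a - lambda) * expR (lambda * (T - ts)) <= a ->
  (1 - lambda / a) * (d / lambda *
     (expR (- lambda * ts) - expR (- lambda * T))) <=
  a^-1 * (expR (- lambda * T) * d).
Proof.
move=> l0 la d0 short; have a0 : 0 < a by exact: lt_trans la.
have -> : expR (- lambda * ts) = expR (- lambda * T) * expR (lambda * (T - ts)).
  by rewrite -expRD; congr expR; ring.
have K : 0 <= expR (- lambda * T) * d / (a * lambda).
  by apply: divr_ge0; apply: mulr_ge0; rewrite ?expR_ge0// ltW.
rewrite -subr_ge0.
set X := expR (lambda * _) in short *; set Y := expR _ in K *.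
have -> : a^-1 * (Y * d) - (1 - lambda / a) * (d / lambda * (Y * X - Y)) =
    Y * d / (a * lambda) * (a - (a - lambda) * X).
  by field; rewrite !gt_eqF.
by rewrite mulr_ge0// subr_ge0.
Qed.

Lemma lipschitz_right_le (R : realType) (s T L c : R) (w : R -> R) : s < T ->
    lipschitz_itv s T L w -> w s <= 0 -> (forall t : R, s < t < T -> w t = c) ->
  c <= 0.
Proof.
move=> sT Lw ws wc; rewrite leNgt; apply/negP => c0.
have L1 : 0 < `|L| + 1 by rewrite ltr_wpDl.
(* a point t so close to s that w cannot have grown from w s to c *)
pose r := c / (2 * (`|L| + 1)).
have r0 : 0 < r by rewrite divr_gt0// mulr_gt0.
pose m := Num.min ((T - s) / 2) r.
have m0 : 0 < m by rewrite lt_min r0 andbT divr_gt0// subr_gt0.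
have mT : m <= (T - s) / 2 by rewrite ge_min lexx.
have mr : m <= r by rewrite ge_min lexx orbT.
have wsm : w (s + m) = c by apply: wc; lra.
have s1 : s <= s + m by lra.
have s2 : s + m <= T by lra.
have := Lw s _ (lexx s) s1 s2; rewrite wsm addrAC subrr add0r => cL.
have := le_trans (ler_norm _) cL.
have : L * m <= c / 2.
  apply: (@le_trans _ _ ((`|L| + 1) * m)).
    by rewrite ler_wpM2r//; [lra|have := ler_norm L; lra].
  apply: (@le_trans _ _ ((`|L| + 1) * r)); first by rewrite ler_wpM2l//; lra.
  by rewrite /r le_eqVlt; apply/orP; left; apply/eqP; field; rewrite gt_eqF.
by lra.
Qed.

(** Here w is the difference between a state and the candidate, and D a
primitive of the weighted difference. Up to ts the function D decreases, and
from ts on so does E t = D t + (w T / lambda) exp (- lambda t), whose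
derivative is the weighted w t - w T; together with tail_gain_le this is the
inequality. In the case of equality E is constant after ts, hence w = w T there;
since w is continuous with w ts <= 0 this gives w T = 0, and then D is constant
on all of [t0, T]. *)
Lemma weighted_gap (R : realType) (a lambda t0 ts T L : R) (w D : R -> R) :
    0 < lambda -> lambda < a -> t0 <= ts -> ts < T ->
    (a - lambda) * expR (lambda * (T - ts)) <= a ->
    lipschitz_itv t0 T L w -> w t0 = 0 -> 0 <= w T ->
    (forall t : R, t0 <= t <= ts -> w t <= 0) ->
    (forall t : R, ts <= t <= T -> w t <= w T) ->
    (forall t : R, t0 <= t <= T ->
      is_derive t (1 : R) D (expR (- lambda * t) * w t)) ->
  (1 - lambda / a) * (D T - D t0) <= a^-1 * (expR (- lambda * T) * w T) /\
  (a^-1 * (expR (- lambda * T) * w T) <= (1 - lambda / a) * (D T - D t0) ->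
   forall t : R, t0 <= t <= T -> w t = 0).
Proof.
move=> l0 la t0ts tsT short Lw w_t0 w_T w_le0 w_le dD.
have a0 : 0 < a by exact: lt_trans la.
pose E t := D t + (w T / lambda) * expR (- lambda * t).
have dE (t : R) : ts <= t <= T ->
    is_derive t (1 : R) E (expR (- lambda * t) * (w t - w T)).
  move=> st; have st' : t0 <= t <= T by lra.
  apply: is_derive_eq (is_derive_add (dD t st')
    (is_derive_mull (w T / lambda) (is_derive_expRMl (- lambda) t))) _.
  by field; rewrite gt_eqF.
have dE_le0 (t : R) : ts <= t <= T -> expR (- lambda * t) * (w t - w T) <= 0.
  by move=> st; rewrite mulr_ge0_le0 ?expR_ge0// subr_le0 w_le.
have E_decr : E T <= E ts by exact: derive_le0_le (ltW tsT) dE dE_le0.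
have D_decr : D ts <= D t0.
  have dD' (t : R) : t0 <= t <= ts ->
    is_derive t (1 : R) D (expR (- lambda * t) * w t).
    by move=> st; apply: dD; lra.
  apply: (derive_le0_le t0ts dD') => t st.
  by rewrite mulr_ge0_le0 ?expR_ge0// w_le0.
have gain := tail_gain_le l0 la w_T short.
have DE : D T - D t0 = (E T - E ts) + (D ts - D t0) +
    w T / lambda * (expR (- lambda * ts) - expR (- lambda * T)).
  by rewrite /E; ring.
have coef0 : 0 < 1 - lambda / a by rewrite subr_gt0 ltr_pdivrMr// mul1r.
split; first by apply: le_trans gain; rewrite ler_pM2l// DE; lra.
move=> /(le_trans gain); rewrite ler_pM2l// DE => gap.
have ET : E ts <= E T by lra.
have wT (t : R) : ts < t < T -> w t = w T.
  move=> /(derive_le0_eq0 dE dE_le0 ET) /eqP.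
  by rewrite mulf_eq0 gt_eqF ?expR_gt0//= subr_eq0 => /eqP.
have wT0 : w T = 0.
  apply/eqP; rewrite eq_le w_T andbT.
  have Lw' : lipschitz_itv ts T L w.
    by move=> y z sy yz zT; apply: Lw => //; lra.
  by apply: lipschitz_right_le Lw' _ wT => //; apply: w_le0; lra.
move=> t st.
have [->//|tt0] := eqVneq t t0.
have [->//|tT] := eqVneq t T.
have st' : t0 < t < T.
  by move: st; rewrite !le_eqVlt eq_sym (negbTE tt0) (negbTE tT).
have Dw_le0 (y : R) : t0 <= y <= T -> expR (- lambda * y) * w y <= 0.
  move=> sy; rewrite mulr_ge0_le0 ?expR_ge0//.
  have [yts|tsy] := leP y ts; first by apply: w_le0; lra.
  by rewrite -wT0; apply: w_le; lra.
have DT : D t0 <= D T by move: DE; rewrite wT0; lra.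
have /eqP := derive_le0_eq0 dD Dw_le0 DT st'.
by rewrite mulf_eq0 gt_eqF ?expR_gt0//= => /eqP.
Qed.

(** * The extremal process *)

(** The smallest end value that the speed limit a and the bound -1 allow. *)
Definition extremal_end (R : realType) (a t0 T x0 : R) : R :=
  Num.max (-1) (x0 - a * (T - t0)).

Definition extremal_state (R : realType) (a t0 T x0 t : R) : R :=
  Num.min (Num.min (x0 + a * (t - t0)) 1)
          (extremal_end a t0 T x0 + a * (T - t)).

(** The times at which two branches of the envelope meet: the rising line and
the constant 1 at rise_time, the constant 1 and the line falling to y at
fall_time, the two lines at crossing_time. They may be out of order or outside
of [t0, T], depending on the case of the theorem. *)
Definition rise_time (R : realType) (a t0 x0 : R) : R := t0 + a^-1 * (1 - x0).

Definition fall_time (R : realType) (a T y : R) : R := T - a^-1 * (1 - y).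

Definition crossing_time (R : realType) (a t0 T x0 y : R) : R :=
  2^-1 * (T + t0 + a^-1 * (y - x0)).

Definition extremal_control (R : realType) (a t0 T x0 t : R) : R :=
  let y := extremal_end a t0 T x0 in
  let tc := crossing_time a t0 T x0 y in
  if t < Num.min (rise_time a t0 x0) tc then -1
  else if Num.max (fall_time a T y) tc < t then 1 else 0.

Lemma extremal_end_ge (R : realType) (a t0 T x0 : R) :
  -1 <= extremal_end a t0 T x0 /\
  x0 - a * (T - t0) <= extremal_end a t0 T x0.
Proof. by rewrite !le_max !lexx orbT. Qed.

Lemma extremal_end_le (R : realType) (a t0 T x0 : R) : 0 < a -> t0 < T ->
    -1 <= x0 <= 1 ->
  extremal_end a t0 T x0 <= 1 /\ extremal_end a t0 T x0 <= x0 + a * (T - t0).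
Proof.
move=> a0 t0T x0b; have : 0 < a * (T - t0) by rewrite mulr_gt0// subr_gt0.
by move=> aT; rewrite !ge_max; split; apply/andP; split; lra.
Qed.

Lemma extremal_state_start (R : realType) (a t0 T x0 : R) :
  -1 <= x0 <= 1 -> extremal_state a t0 T x0 t0 = x0.
Proof.
move=> x0b; have [_ yge] := extremal_end_ge a t0 T x0.
rewrite /extremal_state; set y := extremal_end _ _ _ _ in yge *.
by rewrite subrr mulr0 addr0 !min_l//; lra.
Qed.

Lemma extremal_state_end (R : realType) (a t0 T x0 : R) : 0 < a -> t0 < T ->
  -1 <= x0 <= 1 -> extremal_state a t0 T x0 T = extremal_end a t0 T x0.
Proof.
move=> a0 t0T x0b; have [y1 yle] := extremal_end_le a0 t0T x0b.
rewrite /extremal_state subrr mulr0 addr0 min_r//.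
by rewrite le_min yle y1.
Qed.

Lemma extremal_state_bound (R : realType) (a t0 T x0 t : R) : 0 < a ->
  -1 <= x0 <= 1 -> t0 <= t <= T -> -1 <= extremal_state a t0 T x0 t <= 1.
Proof.
move=> a0 x0b st; have [yge _] := extremal_end_ge a t0 T x0.
rewrite /extremal_state; set y := extremal_end _ _ _ _ in yge *.
have a1 : 0 <= a * (t - t0) by apply: mulr_ge0; lra.
have a2 : 0 <= a * (T - t) by apply: mulr_ge0; lra.
rewrite !le_min !ge_min lexx orbT/= andbT.
by apply/andP; split; [apply/andP; split|]; lra.
Qed.

Lemma lipschitz_itv_min (R : realType) (s T L : R) (f g : R -> R) :
    lipschitz_itv s T L f -> lipschitz_itv s T L g ->
  lipschitz_itv s T L (fun t => Num.min (f t) (g t)).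
Proof.
move=> Lf Lg p q sp pq qT.
have := Lf p q sp pq qT; have := Lg p q sp pq qT; rewrite !ler_norml.
by case: (leP (f p) (g p)) => ?; case: (leP (f q) (g q)) => ? ? ?; lra.
Qed.

Lemma extremal_state_lipschitz (R : realType) (a t0 T x0 : R) : 0 < a ->
  lipschitz_itv t0 T a (extremal_state a t0 T x0).
Proof.
move=> a0; have apq (p q : R) : p <= q -> 0 <= a * (q - p).
  by move=> pq; apply: mulr_ge0; lra.
by apply: lipschitz_itv_min; [apply: lipschitz_itv_min|];
  move=> p q _ /apq pq _; rewrite ler_norml; lra.
Qed.

Lemma extremal_state_derive (R : realType) (a t0 T x0 t : R) : 0 < a ->
    let y := extremal_end a t0 T x0 in
    t != rise_time a t0 x0 -> t != fall_time a T y ->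
    t != crossing_time a t0 T x0 y ->
  is_derive t (1 : R) (extremal_state a t0 T x0)
    (- a * extremal_control a t0 T x0 t).
Proof.
move=> a0 y; rewrite /extremal_control -/y.
rewrite (_ : extremal_state a t0 T x0 = fun s =>
  Num.min (Num.min (x0 + a * (s - t0)) 1) (y + a * (T - s)))//.
have [rE fE cE] : [/\ a * rise_time a t0 x0 = a * t0 + 1 - x0,
   a * fall_time a T y = a * T - 1 + y &
   2 * (a * crossing_time a t0 T x0 y) = a * T + a * t0 + y - x0].
  by split; rewrite /rise_time /fall_time /crossing_time; field; rewrite gt_eqF.
move: (rise_time _ _ _) (fall_time _ _ _) (crossing_time _ _ _ _ _) rE fE cE.
move: y => y r f c rE fE cE tr tf tc.
(* outside the three switching times the envelope coincides near t with one
   of its three branches *)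
have mono (p q : R) : p < q -> a * p < a * q by rewrite ltr_pM2l.
have near_itv (p q : R) (g h : R -> R) (l : R) : p < t < q ->
    (forall s, p < s < q -> g s = h s) -> is_derive t (1 : R) g l ->
    is_derive t (1 : R) h l.
  move=> pq gh; apply: near_eq_is_derive.
  have : t \in `]p, q[ by rewrite in_itv/=.
  by move=> /near_in_itvoo; apply: filterS => s /=; rewrite in_itv/= => /gh.
have [|rt] := ltP t (Num.min r c).
  move=> trc; apply: (@near_itv (t - 1) (Num.min r c)
      (fun s => x0 + a * (s - t0))); first by lra.
    move=> s /andP[_]; rewrite lt_min => /andP[/mono sr /mono sc].
    by rewrite (@min_l _ _ (x0 + _)) ?min_l//; lra.
  apply: is_derive_eq (is_derive_add (is_derive_cst x0 t 1)
    (is_derive_mull a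
      (is_derive_sub (is_derive_id t 1) (is_derive_cst t0 t 1)))) _.
  by ring.
have [ft|tf'] := ltP (Num.max f c) t.
  apply: (@near_itv (Num.max f c) (t + 1) (fun s => y + a * (T - s))).
    by lra.
    move=> s /andP[+ _]; rewrite gt_max => /andP[/mono fs /mono cs].
    by rewrite min_r// le_min; apply/andP; split; lra.
  apply: is_derive_eq (is_derive_add (is_derive_cst y t 1)
    (is_derive_mull a
      (is_derive_sub (is_derive_cst T t 1) (is_derive_id t 1)))) _.
  by ring.
have anti (p q : R) : a * p < a * q -> p < q by rewrite ltr_pM2l.
have [rlt tlf] : r < t /\ t < f.
  move: rt tf'; rewrite ge_min le_max.
  have [ct|tc'|ct] := ltgtP c t; last by rewrite ct eqxx in tc.
    rewrite orbF => _; rewrite le_eqVlt (negbTE tf)/= => tf'; split => //.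
    by apply: anti; have := mono _ _ ct; have := mono _ _ tf'; lra.
  rewrite orbF le_eqVlt eq_sym (negbTE tr)/= => rt _; split => //.
  by apply: anti; have := mono _ _ tc'; have := mono _ _ rt; lra.
apply: (@near_itv r f (cst 1)); first by rewrite rlt.
  move=> s /andP[/mono rs /mono sf].
  by rewrite (@min_r _ _ (x0 + _)) ?min_l//; lra.
by rewrite mulr0; exact: is_derive_cst.
Qed.

Lemma extremal_control_bound (R : realType) (a t0 T x0 t : R) :
  -1 <= extremal_control a t0 T x0 t <= 1.
Proof.
by rewrite /extremal_control; case: ifP => _; [|case: ifP => _]; lra.
Qed.

Lemma extremal_control_measurable (R : realType) (a t0 T x0 : R) :
  Lmeasurable_on t0 T (extremal_control a t0 T x0).
Proof.
have : @measurable_fun _ _ (measurableTypeR R) (measurableTypeR R) setT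
    (extremal_control a t0 T x0).
  rewrite /extremal_control.
  apply: measurable_fun_ifT => //; last apply: measurable_fun_ifT => //.
  - exact: measurable_fun_ltr.
  - exact: measurable_fun_ltr.
move=> mu mD B mB; apply: sub_caratheodory.
exact: (measurable_funTS mu).
Qed.

Lemma extremal_dynamics (R : realType) (a t0 T x0 : R) : 0 < a ->
  ae_on t0 T (fun t => is_derive t (1 : R) (extremal_state a t0 T x0)
    (- a * extremal_control a t0 T x0 t)).
Proof.
move=> a0; pose y := extremal_end a t0 T x0.
apply: (ae_onS2 _ (ae_on_neq t0 T (rise_time a t0 x0))
  (ae_onS2 (fun t _ tf tc => conj tf tc) (ae_on_neq t0 T (fall_time a T y))
  (ae_on_neq t0 T (crossing_time a t0 T x0 y)))).
by move=> t _ tr [tf tc]; exact: extremal_state_derive.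
Qed.

Lemma extremal_feasible (R : realType) (a t0 T x0 : R) : 0 < a ->
    -1 <= x0 <= 1 ->
  fp3_feasible a t0 T x0
    (extremal_state a t0 T x0) (extremal_control a t0 T x0).
Proof.
move=> a0 x0b; split.
- apply: (@lipschitz_absolutely_continuous _ _ _ a).
  exact: extremal_state_lipschitz.
- exact: extremal_control_measurable.
- exact: extremal_dynamics.
- exact: extremal_state_start.
- by apply: ae_onS (ae_on_neq t0 T t0) => t _ _; exact: extremal_control_bound.
- by move=> t; exact: extremal_state_bound.
Qed.

(** The end value is x0 - a (T - t0), and the falling line through it passes
through x0 at t0, so it is the lowest branch throughout. *)
Lemma extremal_state_short (R : realType) (a t0 T x0 t : R) : 0 < a ->
    -1 <= x0 <= 1 -> T - t0 <= a^-1 * (1 + x0) -> t0 <= t <= T ->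
  extremal_state a t0 T x0 t = x0 - a * (t - t0).
Proof.
move=> a0 x0b; rewrite -(ler_pM2l a0) mulVKf ?gt_eqF// => Tt0 st.
have at0 : 0 <= a * (t - t0) by apply: mulr_ge0; lra.
rewrite /extremal_state /extremal_end max_r; last by lra.
by rewrite min_r ?le_min; [ring|apply/andP; split; lra].
Qed.

(** The end value is -1 as soon as there is time to reach it. *)
Lemma extremal_state_long (R : realType) (a t0 T x0 t : R) : 0 < a ->
    a^-1 * (1 + x0) <= T - t0 ->
  extremal_state a t0 T x0 t =
    Num.min (Num.min (x0 + a * (t - t0)) 1) (-1 - a * (t - T)).
Proof.
move=> a0; rewrite -(ler_pM2l a0) mulVKf ?gt_eqF// => Tt0.
by rewrite /extremal_state /extremal_end max_l; [congr Num.min; ring|lra].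
Qed.

(** The two lines cross before the rising one reaches 1. *)
Lemma extremal_state_medium (R : realType) (a t0 T x0 t : R) : 0 < a ->
    a^-1 * (1 + x0) < T - t0 < a^-1 * (3 - x0) ->
    let tz := 2^-1 * (T + t0 - a^-1 * (1 + x0)) in
  extremal_state a t0 T x0 t =
    if t <= tz then x0 + a * (t - t0) else -1 - a * (t - T).
Proof.
move=> a0 /andP[Tl Tu] tz; rewrite (extremal_state_long _ a0 (ltW Tl)).
move: Tl; rewrite -(ltr_pM2l a0) mulVKf ?gt_eqF// => Tl.
move: Tu; rewrite -(ltr_pM2l a0) mulVKf ?gt_eqF// => Tu.
have tzE : 2 * (a * tz) = a * T + a * t0 - (1 + x0).
  by rewrite /tz; field; rewrite gt_eqF.
move: tz tzE => tz tzE; case: (leP t tz) => [|].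
  rewrite -(ler_pM2l a0) => ttz.
  by rewrite (@min_l _ _ (x0 + _)) ?min_l//; lra.
rewrite -(ltr_pM2l a0) => ttz.
by rewrite min_r// le_min; apply/andP; split; lra.
Qed.

Lemma extremal_state_turnpike (R : realType) (a t0 T x0 t : R) : 0 < a ->
    -1 <= x0 <= 1 -> a^-1 * (3 - x0) <= T - t0 ->
  extremal_state a t0 T x0 t =
    if t <= t0 + a^-1 * (1 - x0) then x0 + a * (t - t0)
    else if t <= T - 2 * a^-1 then 1 else -1 - a * (t - T).
Proof.
move=> a0 x0b Tl; rewrite extremal_state_long//; last first.
  by apply: le_trans Tl; rewrite ler_pM2l ?invr_gt0//; lra.
move: Tl; rewrite -(ler_pM2l a0) mulVKf ?gt_eqF// => Tl.
have rE : a * (t0 + a^-1 * (1 - x0)) = a * t0 + 1 - x0.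
  by field; rewrite gt_eqF.
have fE : a * (T - 2 * a^-1) = a * T - 2 by field; rewrite gt_eqF.
move: (t0 + a^-1 * (1 - x0)) (T - 2 * a^-1) rE fE => r f rE fE.
case: (leP t r); [rewrite -(ler_pM2l a0) => tr|rewrite -(ltr_pM2l a0) => rt].
  by rewrite (@min_l _ _ (x0 + _)) ?min_l//; lra.
case: (leP t f); [rewrite -(ler_pM2l a0) => tf|rewrite -(ltr_pM2l a0) => ft].
  by rewrite (@min_r _ _ (x0 + _)) ?min_l//; lra.
by rewrite (@min_r _ _ (x0 + _)) ?min_r//; lra.
Qed.

(** * Optimality of the extremal process *)

(** An instance of weighted_gap with ts = max (t0, T - 2 / a): before T - 2 / a
the falling branch of the envelope exceeds 1, so the candidate is the upper
envelope of all feasible states there; at any time it is exceeded by at most the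
difference of the end values. *)
Lemma extremal_gap (R : realType) (a lambda t0 T x0 : R) (x u : R -> R) :
    0 < lambda -> lambda < a -> 0 <= t0 -> t0 < T -> -1 <= x0 <= 1 ->
    2 * a^-1 <= lambda^-1 * ln (a / (a - lambda)) ->
    fp3_feasible a t0 T x0 x u ->
  let xb := extremal_state a t0 T x0 in
  let ub := extremal_control a t0 T x0 in
  fp3_cost lambda t0 T xb ub <= fp3_cost lambda t0 T x u /\
  (fp3_cost lambda t0 T x u <= fp3_cost lambda t0 T xb ub ->
   forall t : R, t0 <= t <= T -> x t = xb t).
Proof.
move=> l0 la t00 t0T x0b rho fx xb ub.
have a0 : 0 < a by exact: lt_trans la.
have fb := extremal_feasible t0 T a0 x0b.
have Lx := feasible_lipschitz a0 fx; have Lb := feasible_lipschitz a0 fb.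
have [P dP] := weighted_primitive lambda (ltW t0T) Lx.
have [Q dQ] := weighted_primitive lambda (ltW t0T) Lb.
rewrite (fp3_costE l0 a0 t00 t0T fx dP) (fp3_costE l0 a0 t00 t0T fb dQ).
rewrite -/xb in Lb dQ *.
have xt0 : x t0 = x0 by case: fx.
have x1 : forall t : R, t0 <= t <= T -> -1 <= x t <= 1 by case: fx.
have bt0 : xb t0 = x0 by exact: extremal_state_start.
have bT : xb T = extremal_end a t0 T x0 by exact: extremal_state_end.
pose ts := Num.max t0 (T - 2 * a^-1).
have ats : a * (T - 2 * a^-1) = a * T - 2 by field; rewrite gt_eqF.
have a2 : 0 < 2 * a^-1 by rewrite mulr_gt0// invr_gt0.
have Tts : T - ts <= 2 * a^-1.
  have : T - 2 * a^-1 <= ts by rewrite le_max lexx orbT.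
  by lra.
have short : (a - lambda) * expR (lambda * (T - ts)) <= a.
  rewrite mulrC -ler_pdivlMr ?subr_gt0//.
  have al0 : 0 < a / (a - lambda) by rewrite divr_gt0// subr_gt0.
  rewrite -[leRHS]lnK ?posrE// ler_expR -ler_pdivlMl//.
  exact: le_trans rho.
have xA (t : R) : t0 <= t <= T -> x t <= x0 + a * (t - t0).
  move=> /andP[t0t tT]; have := le_trans (ler_norm _) (Lx _ _ (lexx t0) t0t tT).
  by rewrite xt0; lra.
have xB (t : R) : t0 <= t <= T -> x t <= x T + a * (T - t).
  move=> /andP[t0t tT]; have := Lx _ _ t0t tT (lexx T).
  by rewrite distrC => /(le_trans (ler_norm _)); lra.
have w_T : 0 <= x T - xb T.
  rewrite subr_ge0 bT ge_max; apply/andP; split.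
    by have := x1 T; rewrite (ltW t0T) lexx => /(_ isT) /andP[].
  have := Lx t0 T (lexx _) (ltW t0T) (lexx _).
  by rewrite distrC xt0 => /(le_trans (ler_norm _)); lra.
have w_le (t : R) : t0 <= t <= T -> x t - xb t <= x T - xb T.
  move=> st; have := xA t st; have := xB t st; have := x1 t st; move: w_T.
  rewrite bT /xb /extremal_state; set y := extremal_end _ _ _ _.
  by rewrite !minElt; case: ifP => _; [case: ifP => _|]; lra.
have w_le0 (t : R) : t0 <= t <= ts -> x t - xb t <= 0.
  move=> /andP[t0t]; rewrite le_max => /orP[tt0|tT].
    have -> : t = t0 by apply/eqP; rewrite eq_le tt0 t0t.
    by rewrite xt0 bt0 subrr.
  have st : t0 <= t <= T by lra.
  have aT : 2 <= a * (T - t).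
    have : 2 * a^-1 <= T - t by lra.
    by rewrite -(ler_pM2l a0) mulrCA divff ?gt_eqF// mulr1.
  have := xA t st; have := x1 t st; have [y1 _] := extremal_end_ge a t0 T x0.
  rewrite subr_le0 /xb /extremal_state !le_min; move: y1.
  set y := extremal_end _ _ _ _ => y1 xt xAt.
  by rewrite xAt/=; apply/andP; split; lra.
have t0ts : t0 <= ts by rewrite le_max lexx.
have tsT : ts < T by rewrite gt_max t0T/=; lra.
have dD (t : R) : t0 <= t <= T -> is_derive t (1 : R) (fun t => P t - Q t)
    (expR (- lambda * t) * (x t - xb t)).
  move=> st; apply: is_derive_eq (is_derive_sub (dP t st) (dQ t st)) _.
  by ring.
have w_t0 : x t0 - xb t0 = 0 by rewrite xt0 bt0 subrr.
have w_le' (t : R) : ts <= t <= T -> x t - xb t <= x T - xb T.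
  by move=> st; apply: w_le; lra.
have [gain eq0] := weighted_gap l0 la t0ts tsT short (lipschitz_itvB Lx Lb)
  w_t0 w_T w_le0 w_le' dD.
split; first by move: gain; lra.
move=> cost_le t st; apply/eqP; rewrite -subr_eq0; apply/eqP; apply: eq0 => //.
by move: cost_le; lra.
Qed.

(** The control is - a^-1 times the derivative of the state at almost every
interior time. *)
Lemma feasible_control_unique (R : realType) (a t0 T x0 : R)
    (x u y v : R -> R) : 0 < a ->
    fp3_feasible a t0 T x0 x u -> fp3_feasible a t0 T x0 y v ->
    (forall t : R, t0 <= t <= T -> x t = y t) ->
  ae_on t0 T (fun t => u t = v t).
Proof.
move=> a0 [_ _ dx _ _ _] [_ _ dy _ _ _] xy.
have inner : ae_on t0 T (fun t => t != t0 /\ t != T).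
  by apply: ae_onS2 (ae_on_neq t0 T t0) (ae_on_neq t0 T T).
apply: (ae_onS2 _ inner (ae_onS2 (fun t _ dxt dyt => conj dxt dyt) dx dy)).
move=> t st [tt0 tT] [dxt dyt].
have : is_derive t (1 : R) y (- a * u t).
  apply: near_eq_is_derive dxt.
  have : t \in `]t0, T[.
    rewrite in_itv/=; move: st.
    by rewrite !le_eqVlt eq_sym (negbTE tt0) (negbTE tT).
  move=> /near_in_itvoo; apply: filterS => s /=.
  by rewrite in_itv/= => si; rewrite xy//; lra.
move=> [_ yu]; case: dyt => [_ yv]; move: yu; rewrite yv.
by move=> /mulfI => /(_ _)/esym; apply; rewrite oppr_eq0 gt_eqF.
Qed.

(** * Local solutions are global *)

Definition segment_process (R : realType) (r : R) (x y : R -> R) (t : R) : R :=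
  x t + r * (y t - x t).

Lemma segment_feasible (R : realType) (a t0 T x0 r : R) (x u y v : R -> R) :
    0 < a -> 0 <= r <= 1 ->
    fp3_feasible a t0 T x0 x u -> fp3_feasible a t0 T x0 y v ->
  fp3_feasible a t0 T x0 (segment_process r x y) (segment_process r u v).
Proof.
move=> a0 r01 fx fy.
have convex_bound (p q : R) : -1 <= p <= 1 -> -1 <= q <= 1 ->
    -1 <= p + r * (q - p) <= 1.
  move=> /andP[p1 p2] /andP[q1 q2].
  have ge0 (c z : R) : 0 <= c -> 0 <= z -> 0 <= c * z by exact: mulr_ge0.
  have := ge0 r (1 - q); have := ge0 r (q + 1).
  have := ge0 (1 - r) (1 - p); have := ge0 (1 - r) (p + 1).
  have -> : 0 <= 1 - r by lra.
  have -> : 0 <= r by lra.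
  have -> : 0 <= 1 - p by lra.
  have -> : 0 <= p + 1 by lra.
  have -> : 0 <= 1 - q by lra.
  have -> : 0 <= q + 1 by lra.
  move=> /(_ isT isT) H1 /(_ isT isT) H2 /(_ isT isT) H3 /(_ isT isT) H4.
  by lra.
have Lx := feasible_lipschitz a0 fx; have Ly := feasible_lipschitz a0 fy.
case: fx => _ mu dx xt0 u1 x1; case: fy => _ mv dy yt0 v1 y1.
split.
- apply: (@lipschitz_absolutely_continuous _ _ _ (a + `|- r| * (a + a))).
  have := lipschitz_itvB Lx (lipschitz_itvZ (- r) (lipschitz_itvB Ly Lx)).
  congr lipschitz_itv; apply/funext => t.
  by rewrite /segment_process mulNr opprK.
- apply: measurable_funD => //.
  by apply: measurable_funM; [exact: measurable_cst|exact: measurable_funB].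
- apply: ae_onS2 dx dy => t _ dxt dyt.
  apply: is_derive_eq (is_derive_add dxt
    (is_derive_mull r (is_derive_sub dyt dxt))) _.
  by rewrite /segment_process; ring.
- by rewrite /segment_process xt0 yt0 subrr mulr0 addr0.
- by apply: ae_onS2 u1 v1 => t _; exact: convex_bound.
- by move=> t st; apply: convex_bound; [exact: x1|exact: y1].
Qed.

(** The formula of fp3_costE is affine in the state and its primitive. *)
Lemma segment_cost (R : realType) (a lambda t0 T x0 r : R)
    (x u y v : R -> R) :
    0 < lambda -> 0 < a -> 0 <= t0 -> t0 < T -> 0 <= r <= 1 ->
    fp3_feasible a t0 T x0 x u -> fp3_feasible a t0 T x0 y v ->
  fp3_cost lambda t0 T (segment_process r x y) (segment_process r u v) =
  fp3_cost lambda t0 T x u +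
    r * (fp3_cost lambda t0 T y v - fp3_cost lambda t0 T x u).
Proof.
move=> l0 a0 t00 t0T r01 fx fy.
have [P dP] := weighted_primitive lambda (ltW t0T) (feasible_lipschitz a0 fx).
have [Q dQ] := weighted_primitive lambda (ltW t0T) (feasible_lipschitz a0 fy).
have dPQ (t : R) : t0 <= t <= T -> is_derive t (1 : R) (segment_process r P Q)
    (expR (- lambda * t) * segment_process r x y t).
  move=> st; apply: is_derive_eq (is_derive_add (dP t st)
    (is_derive_mull r (is_derive_sub (dQ t st) (dP t st)))) _.
  by rewrite /segment_process; ring.
rewrite (fp3_costE l0 a0 t00 t0T (segment_feasible a0 r01 fx fy) dPQ).
rewrite (fp3_costE l0 a0 t00 t0T fx dP) (fp3_costE l0 a0 t00 t0T fy dQ).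
by rewrite /segment_process; ring.
Qed.

(** The derivative of f agrees with g only almost everywhere; completeness of
the measure makes it measurable all the same. *)
Lemma W11_norm_le (R : realType) (s T M : R) (f g : R -> R) :
    s <= T -> 0 <= M -> f s = 0 -> Lmeasurable_on s T g ->
    ae_on s T (fun t => is_derive t (1 : R) f (g t)) ->
    ae_on s T (fun t => `|g t| <= M) ->
  W11_norm s T f <= M * (T - s).
Proof.
move=> sT M0 fs mg df gM.
rewrite /W11_norm fs normr0 add0r /Lintegral /Rintegral.
pose mu := @completed_lebesgue_measure R.
have mI : @measurable _ (lebesgue_type R) `[s, T].
  by apply: sub_caratheodory; exact: measurable_itv.
have dfE : ae_on s T (fun t => derive1 f t = g t).
  by apply: ae_onS df => t _ [_ <-]; rewrite derive1E.
have aeE : ae_eq mu [set` `[s, T]] (EFin \o g) (EFin \o derive1 f).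
  apply: (@filterS _ _ (ae_completed_filter R)) dfE => t /= H.
  by rewrite in_itv/= => st; rewrite H.
have mf : @measurable_fun _ _ (lebesgue_type R) _ `[s, T] (EFin \o derive1 f).
  apply: (ae_measurable_fun completed_lebesgue_measure_is_complete aeE).
  exact/measurable_EFinP.
have le_int : (\int[mu]_(t in `[s, T]) `|(derive1 f t)%:E| <=
    M%:E * mu [set` `[s, T]])%E.
  apply: integral_le_bound => //.
  have : ae_on s T (fun t => `|derive1 f t| <= M).
    by apply: ae_onS2 dfE gM => t _ ->.
  apply: (@filterS _ _ (ae_completed_filter R)) => t /= H.
  by rewrite in_itv/= => st; rewrite lee_fin H.
rewrite [X in (_ * X)%E](completed_lebesgue_measure_itv sT) in le_int.
rewrite -lee_fin fineK.
  exact: le_int.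
rewrite ge0_fin_numE; last by apply: integral_ge0 => t _; rewrite lee_fin.
exact: le_lt_trans le_int (ltry _).
Qed.

(** Moving from x towards y by a fraction r multiplies the gap in cost by r, and
the distance covered is at most 2 a r (T - t0), since both derivatives are
bounded by a. *)
Lemma local_solution_global (R : realType) (a lambda t0 T x0 : R)
    (x u y v : R -> R) :
    0 < lambda -> 0 < a -> 0 <= t0 -> t0 < T ->
    fp3_local_solution a lambda t0 T x0 x u -> fp3_feasible a t0 T x0 y v ->
  fp3_cost lambda t0 T x u <= fp3_cost lambda t0 T y v.
Proof.
move=> l0 a0 t00 t0T [fx [d d0 xmin]] fy.
pose K := 2 * a * (T - t0).
have K0 : 0 < K by rewrite !mulr_gt0// subr_gt0.
pose r := Num.min 1 (d / K).
have r0 : 0 < r by rewrite lt_min ltr01/= divr_gt0.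
have r1 : r <= 1 by rewrite ge_min lexx.
have rd : r * K <= d by rewrite -ler_pdivlMr// ge_min lexx orbT.
have r01 : 0 <= r <= 1 by rewrite (ltW r0).
have := xmin _ _ (segment_feasible a0 r01 fx fy).
rewrite (segment_cost l0 a0 t00 t0T r01 fx fy).
suff close : W11_norm t0 T (x - segment_process r x y) <= d.
  move=> /(_ close); rewrite lerDl pmulr_rge0// subr_ge0; exact.
apply: le_trans rd.
have -> : r * K = 2 * a * r * (T - t0) by rewrite /K; ring.
case: fx => _ mu dx xt0 u1 _; case: fy => _ mv dy yt0 v1 _.
have diffE : x - segment_process r x y = fun t => r * (x t - y t).
  apply/funext => t; transitivity (x t - segment_process r x y t) => //.
  by rewrite /segment_process; ring.
rewrite diffE.
apply: (@W11_norm_le _ _ _ _ _ (fun t => r * (- a * u t - - a * v t))).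
- exact: ltW.
- by rewrite !mulr_ge0// ltW.
- by rewrite xt0 yt0 subrr mulr0.
- apply: measurable_funM; first exact: measurable_cst.
  by apply: measurable_funB; apply: measurable_funM => //;
    exact: measurable_cst.
- apply: ae_onS2 dx dy => t _ dxt dyt.
  exact: is_derive_eq (is_derive_mull r (is_derive_sub dxt dyt)) _.
- apply: ae_onS2 u1 v1 => t _ ut vt.
  rewrite normrM (gtr0_norm r0) mulrC ler_pM2r//.
  rewrite -mulrBr normrM normrN (gtr0_norm a0) mulrC ler_pM2r//.
  by rewrite ler_norml; lra.
Qed.

(** * Uniqueness of local and global solutions *)

Theorem theorem3p8 (R : realType) (a lambda t0 T x0 rho : R)
    (lambda_gt0 : 0 < lambda) (lambda_lt_a : lambda < a)
    (t0_ge0 : 0 <= t0) (t0_lt_T : t0 < T) (x0_bound : -1 <= x0 <= 1)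
    (rhoE : rho = lambda^-1 * ln (a / (a - lambda))) :
  0 < rho /\
  (2 * a^-1 <= rho ->
   exists xb ub : R -> R,
     [/\ unique_process t0 T (fp3_local_solution a lambda t0 T x0) xb ub,
         unique_process t0 T (fp3_global_solution a lambda t0 T x0) xb ub,
         ae_on t0 T (fun t => ub t = - a^-1 * derive1 xb t) &
         [/\ T - t0 <= a^-1 * (1 + x0) ->
               forall t, t0 <= t <= T -> xb t = x0 - a * (t - t0),
             a^-1 * (1 + x0) < T - t0 < a^-1 * (3 - x0) ->
               let tz := 2^-1 * (T + t0 - a^-1 * (1 + x0)) in
               forall t, t0 <= t <= T ->
                 xb t = if t <= tz then x0 + a * (t - t0)
                        else -1 - a * (t - T) &
             a^-1 * (3 - x0) <= T - t0 ->
               forall t, t0 <= t <= T ->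
                 xb t = if t <= t0 + a^-1 * (1 - x0) then x0 + a * (t - t0)
                        else if t <= T - 2 * a^-1 then 1
                        else -1 - a * (t - T)]]).
Proof.
have a0 : 0 < a by exact: lt_trans lambda_lt_a.
have al0 : 0 < a - lambda by rewrite subr_gt0.
split.
  rewrite rhoE mulr_gt0 ?invr_gt0// ln_gt0// ltr_pdivlMr// mul1r.
  by rewrite ltrBlDr ltrDl.
rewrite rhoE => rho_ge.
pose xb := extremal_state a t0 T x0; pose ub := extremal_control a t0 T x0.
have fb : fp3_feasible a t0 T x0 xb ub by exact: extremal_feasible.
have gap x u := @extremal_gap R a lambda t0 T x0 x u lambda_gt0 lambda_lt_a
  t0_ge0 t0_lt_T x0_bound rho_ge.
have global_b : fp3_global_solution a lambda t0 T x0 xb ub.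
  by split=> // x u /gap[].
have unique x u : fp3_feasible a t0 T x0 x u ->
    fp3_cost lambda t0 T x u <= fp3_cost lambda t0 T xb ub ->
    same_process t0 T x u xb ub.
  move=> fx /(gap _ _ fx).2 xE; split => //.
  exact: (feasible_control_unique a0 fx fb).
exists xb, ub; split.
- split.
    by split=> //; exists 1 => // x u fx _; case: global_b => _; exact.
  move=> x u xu; have fx := xu.1; apply: unique => //.
  exact: local_solution_global xu fb.
- by split=> // x u [fx xmin]; apply: unique => //; exact: xmin.
- apply: ae_onS (extremal_dynamics t0 T x0 a0) => t _ [_ dxb].
  by rewrite derive1E dxb mulrA mulrNN mulVf ?gt_eqF// mul1r.
- split.
  + by move=> short t; exact: extremal_state_short.
  + by move=> medium tz t _; exact: extremal_state_medium.
  + by move=> long t _; exact: extremal_state_turnpike.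
Qed.
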